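(* Let $R$ be a complete intersection SAGA of codimension $n+1\ge6$ presented by quadrics, and let $z\in R^1\setminus\{0\}$ be a non-Lefschetz element in degree $1$ (i.e. $zw=0$ for some $w\in R^1\setminus\{0\}$). If $\bar R=R/(z)$ satisfies $WLP_2$, then $R$ satisfies $WLP_2$.
   Context: $\mathbb K$ is an algebraically closed field of characteristic $0$. A complete intersection SAGA of codimension $n+1$ presented by quadrics is $R=S/I$, $S=\mathbb K[x_0,\dots,x_n]$, $I$ generated by a regular sequence of $n+1$ homogeneous quadrics (standard graded Artinian Gorenstein, socle degree $n+1$). A graded algebra $A$ satisfies $WLP_k$ if there is $x\in A^1$ such that $x\cdot:A^k\to A^{k+1}$ has maximal rank. An element $[x]\in\mathbb P(R^1)$ is a Lefschetz element in degree $1$ if $x\cdot:R^1\to R^2$ has maximal rank (here: is injective); otherwise it is a non-Lefschetz element. *)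

(* Defs.v *)
From HB Require Import structures.
From mathcomp Require Import all_boot all_algebra.
From mathcomp Require Import mpoly.
Set Implicit Arguments. Unset Strict Implicit. Unset Printing Implicit Defensive.
Import GRing.Theory.
Local Open Scope ring_scope.

(* S = K[x_0..x_n] is {mpoly K[n.+1]}; a graded quotient A = S/J with J
   generated by homogeneous forms [gens].  The graded piece A^k is
   S_k / (J ∩ S_k), where S_k = forms of degree k ([k.-homog]). *)

Section Defs.
Variables (K : fieldType) (m : nat).
Implicit Types (gens : seq {mpoly K[m]}) (f g l : {mpoly K[m]}).

Definition in_ideal gens f : Prop :=
  exists c : 'I_(size gens) -> {mpoly K[m]},
    f = \sum_(i < size gens) c i * gens`_i.

Definition regular_seq gens : Prop :=
  ~ in_ideal gens 1 /\
  forall i : nat, (i < size gens)%N ->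
    forall g, in_ideal (take i gens) (gens`_i * g) -> in_ideal (take i gens) g.

Definition mult_inj gens k l : Prop :=
  forall f, f \is k.-homog -> in_ideal gens (l * f) -> in_ideal gens f.

Definition mult_surj gens k l : Prop :=
  forall g, g \is k.+1.-homog ->
    exists f, f \is k.-homog /\ in_ideal gens (g - l * f).

Definition mult_max_rank gens k l : Prop := mult_inj gens k l \/ mult_surj gens k l.

Definition WLP gens k : Prop :=
  exists l, l \is 1.-homog /\ mult_max_rank gens k l.

(* complete intersection SAGA of codimension m presented by quadrics:
   S/(gens) with gens a regular sequence of m quadrics in m variables *)
Definition CI_quadrics gens : Prop :=
  size gens = m /\ (forall q, q \in gens -> q \is 2.-homog) /\ regular_seq gens.

End Defs.

(* Main.v *)
Require Import Defs.
From HB Require Import structures.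
From mathcomp Require Import all_boot all_algebra.
From mathcomp Require Import mpoly.
From mathcomp Require Import ring zify.
From Stdlib Require Import Classical.
Set Implicit Arguments. Unset Strict Implicit. Unset Printing Implicit Defensive.
Import GRing.Theory.
Local Open Scope ring_scope.

(** Let [z w = 0] in [R] with [w] linear. If a linear form [l1] is injective from
    degree 2 to degree 3 of [R/(z)], and a linear form [l2] satisfies
    [z l2 g = 0 -> z g = 0] for all linear [g], then a general member [l] of the
    pencil of [l1] and [l2] has both properties. For such an [l], [l f = 0] with
    [f] a quadric forces [f = z g] by the first one, and then [f = 0] by the second.

    If no [l2] existed, then for every linear [g] there would be a linear [h]
    with [z h g = 0] and [z h <> 0]. Syzygies of a regular sequence have
    coefficients in its ideal, which shows that the linear forms killed by [z h]
    are spanned by [w] and [g] when [z g <> 0]. Deforming [h] in an arbitrary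
    direction [m] then yields [z m g^2 = 0], and by polarization [z] kills all
    cubics. Since the annihilator of [z] is [(w)], every cubic would lie in
    [(w) + I], which a dimension count excludes when [n >= 5]. If [l1] is only
    known to be surjective on [R/(z)], it is injective by dimensions as well. *)

(** * Ideals and homogeneous components *)

Section Ideal.
Variables (K : fieldType) (m : nat).
Implicit Types (gens : seq {mpoly K[m]}) (f g a u : {mpoly K[m]}).

Lemma in_idealD gens f g : in_ideal gens f -> in_ideal gens g -> in_ideal gens (f + g).
Proof.
case=> c -> [d ->]; exists (fun i => c i + d i).
by rewrite -big_split; apply: eq_bigr => i _; rewrite mulrDl.
Qed.

Lemma in_idealM gens a f : in_ideal gens f -> in_ideal gens (a * f).
Proof.
case=> c ->; exists (fun i => a * c i).
by rewrite mulr_sumr; apply: eq_bigr => i _; rewrite mulrA.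
Qed.

Lemma in_idealN gens f : in_ideal gens f -> in_ideal gens (- f).
Proof. by rewrite -mulN1r; exact: in_idealM. Qed.

Lemma in_idealB gens f g : in_ideal gens f -> in_ideal gens g -> in_ideal gens (f - g).
Proof. by move=> hf hg; apply: in_idealD => //; exact: in_idealN. Qed.

Lemma in_ideal0 gens : in_ideal gens 0.
Proof. by exists (fun=> 0); rewrite big1 // => i _; rewrite mul0r. Qed.

Lemma in_idealZ gens (c : K) f : c != 0 -> in_ideal gens (c *: f) -> in_ideal gens f.
Proof.
by move=> c0 /(in_idealM c^-1%:MP); rewrite mul_mpolyC scalerA mulVf // scale1r.
Qed.

Lemma in_ideal_nth gens (i : 'I_(size gens)) : in_ideal gens gens`_i.
Proof.
exists (fun j => (j == i)%:R); rewrite (bigD1 i) //= eqxx mul1r big1 ?addr0 //.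
by move=> j /negPf ->; rewrite mul0r.
Qed.

(** Coefficients indexed by [nat] keep their type when [r] varies, as the induction in
    [regular_seq_syzygy] requires. *)
Lemma in_ideal_takeP gens r f : (r <= size gens)%N ->
  in_ideal (take r gens) f <->
  exists c : nat -> {mpoly K[m]}, f = \sum_(i < r) c i * gens`_i.
Proof.
move=> hr; have sz : size (take r gens) = r by rewrite size_takel.
rewrite /in_ideal sz; split=> -[c ->].
  exists (fun i => if insub i is Some j then c j else 0).
  by apply: eq_bigr => i _; rewrite valK nth_take.
by exists (fun i => c i); apply: eq_bigr => i _; rewrite nth_take.
Qed.

Lemma in_ideal_take gens r f : (r <= size gens)%N ->
  in_ideal (take r gens) f -> in_ideal gens f.
Proof.
move=> hr /(in_ideal_takeP _ hr)[c ->].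
elim/big_ind: _ => [||i _]; [exact: in_ideal0|exact: in_idealD|].
exact/in_idealM/(in_ideal_nth (widen_ord hr i)).
Qed.

Lemma in_ideal_rcons gens z f :
  in_ideal (rcons gens z) f <-> exists h, in_ideal gens (f - z * h).
Proof.
have hs : (size gens <= size (rcons gens z))%N by rewrite size_rcons.
have nthE (i : 'I_(size gens)) : (rcons gens z)`_i = gens`_i.
  by rewrite nth_rcons ltn_ord.
have nthz : (rcons gens z)`_(size gens) = z by rewrite nth_rcons ltnn eqxx.
split=> [|[h [c fE]]].
  rewrite -{1}(take_size (rcons gens z)) => /(in_ideal_takeP _ (leqnn _)).
  rewrite size_rcons => -[c]; rewrite big_ord_recr /= nthz => ->.
  exists (c (size gens)); exists c.
  by rewrite [z * _]mulrC addrK; apply: eq_bigr => i _; rewrite nthE.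
rewrite -(take_size (rcons gens z)); apply/in_ideal_takeP => //.
(* [insub] fails at index [size gens], so the default value [h] is the coefficient of [z]. *)
rewrite size_rcons; exists (fun i => if insub i is Some j then c j else h).
rewrite big_ord_recr /= nthz insubN ?ltnn // [h * z]mulrC.
apply/eqP; rewrite -subr_eq fE; apply/eqP.
by apply: eq_bigr => i _; rewrite valK nthE.
Qed.

(* A syzygy [c] of length [r + 1] has [c_r = \sum_(i < r) b_i f_i]; then
   [c_i + b_i f_r] is a syzygy of length [r]. *)
Lemma regular_seq_syzygy gens (c : 'I_(size gens) -> {mpoly K[m]}) :
  regular_seq gens -> \sum_(i < size gens) c i * gens`_i = 0 ->
  forall i, in_ideal gens (c i).
Proof.
case=> _ reg.
suff syz r (d : nat -> {mpoly K[m]}) : (r <= size gens)%N ->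
    \sum_(i < r) d i * gens`_i = 0 -> forall i, (i < r)%N -> in_ideal gens (d i).
  move=> c0 i; pose d j := if insub j is Some k then c k else 0.
  have := syz _ d (leqnn _) _ i (ltn_ord i); rewrite /d valK; apply.
  by rewrite -[RHS]c0; apply: eq_bigr => j _; rewrite valK.
elim: r d => // r IHr d hr; rewrite big_ord_recr /= => d0.
have dr : in_ideal (take r gens) (d r).
  apply: reg => //; apply/(in_ideal_takeP _ (ltnW hr)).
  exists (fun i => - d i); apply/eqP; rewrite -subr_eq0 -sumrN.
  rewrite mulrC addrC -[X in _ == X]d0.
  by apply/eqP; congr (_ + _); apply: eq_bigr => i _; rewrite mulNr opprK.
move=> i; rewrite ltnS leq_eqVlt => /predU1P[->|ir].
  exact: in_ideal_take (ltnW hr) dr.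
case/(in_ideal_takeP _ (ltnW hr)): dr => b drE.
have := IHr (fun i => d i + b i * gens`_r) (ltnW hr) _ _ ir.
have -> : \sum_(i0 < r) (d i0 + b i0 * gens`_r) * gens`_i0 = 0.
  rewrite -[RHS]d0 drE mulr_suml -big_split.
  by apply: eq_bigr => j _; rewrite mulrDl mulrAC.
move=> /(_ erefl) /in_idealB /(_ (in_idealM (b i) (in_ideal_nth (Ordinal hr)))).
by rewrite addrK.
Qed.

End Ideal.

Section Homog.
Variables (K : fieldType) (m : nat).
Implicit Types (f g a u v w : {mpoly K[m]}).

Lemma pihomogM d e f g : g \is e.-homog ->
  pihomog mdeg (d + e)%N (f * g) = pihomog mdeg d f * g.
Proof.
move=> hg; pose k := maxn (msize f) d.+1.
have fE : f = \sum_(i < k) pihomog mdeg i f.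
  by apply: pihomog_partitionE; rewrite leq_maxl.
have hd : (d < k)%N by rewrite leq_maxr.
rewrite {1}fE mulr_suml raddf_sum (bigD1 (Ordinal hd)) //= big1 ?addr0.
  by rewrite pihomog_dE // dhomogM // pihomogP.
move=> i ne; apply: (pihomog_ne0 (d := (i + e)%N)); last by rewrite dhomogM // pihomogP.
by rewrite eqn_add2r; apply: contraNneq ne => /= e'; apply/eqP/val_inj.
Qed.

(** Only the components of degree [d] of the coefficients contribute to degree [d + e]. *)
Lemma in_ideal_homog gens e d f : (forall q, q \in gens -> q \is e.-homog) ->
  f \is (d + e)%N.-homog -> in_ideal gens f ->
  exists2 c : 'I_(size gens) -> {mpoly K[m]}, forall i, c i \is d.-homog &
    f = \sum_(i < size gens) c i * gens`_i.
Proof.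
move=> hq hf [c fE]; exists (fun i => pihomog mdeg d (c i)).
  by move=> i; exact: pihomogP.
rewrite -(pihomog_dE hf) fE raddf_sum; apply: eq_bigr => i _ /=.
by rewrite pihomogM // hq // mem_nth.
Qed.

Lemma homog_lt_mul d e f g : (d < e)%N -> g \is e.-homog ->
  pihomog mdeg d (f * g) = 0.
Proof.
move=> hd hg; pose k := msize f.
have fE : f = \sum_(i < k) pihomog mdeg i f by exact: pihomog_partitionE.
rewrite {1}fE mulr_suml raddf_sum big1 // => i _ /=.
apply: (pihomog_ne0 (d := (i + e)%N)); last by rewrite dhomogM // pihomogP.
by apply: contraTneq hd => <-; rewrite -leqNgt leq_addl.
Qed.

Lemma in_ideal_low gens e d f : (forall q, q \in gens -> q \is e.-homog) ->
  (d < e)%N -> f \is d.-homog -> in_ideal gens f -> f = 0.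
Proof.
move=> hq de hf [c fE]; rewrite -(pihomog_dE hf) fE raddf_sum big1 // => i _ /=.
by rewrite (homog_lt_mul _ de) // hq // mem_nth.
Qed.

Lemma homog0C f : f \is 0.-homog -> f = (f@_0%MM)%:MP.
Proof.
move=> /dhomogP hf; apply/mpolyP => k; rewrite mcoeffC.
have [->|kn0] := eqVneq 0%MM k; first by rewrite mulr1.
rewrite mulr0; apply: memN_msupp_eq0; apply: contra kn0 => /hf.
by move/eqP; rewrite mdeg_eq0 => /eqP ->.
Qed.

(** Each monomial is charged to one variable occurring in it. This serves for inductions on the
    degree. *)
Lemma homogSE d f : f \is d.+1.-homog ->
  exists2 q : 'I_m -> {mpoly K[m]}, forall i, q i \is d.-homog &
    f = \sum_i 'X_i * q i.
Proof.
move=> /dhomogP hf; rewrite (mpolyE f) big_seq.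
elim/big_rec: _ => [|k p kf [q hq ->]].
  by exists (fun=> 0) => [i|]; [exact: dhomog0|rewrite big1 // => i _; rewrite mulr0].
have [i ki] : exists i, (0 < k i)%N.
  have dk := hf _ kf; apply/existsP; apply: contraPT dk.
  rewrite negb_exists => /forallP k0; rewrite /= mdegE big1 // => i _.
  by have := k0 i; rewrite lt0n negbK => /eqP.
have kE : k = (U_(i) + (k - U_(i)))%MM.
  by rewrite addmC submK //; apply/mnm_lepP => j; rewrite mnm1E; case: eqP => [<-|].
exists (fun j => q j + (j == i)%:R *: (f@_k *: 'X_[(k - U_(i))%MM])).
  move=> j; rewrite rpredD // rpredZ // rpredZ // dhomogX /=; apply/eqP.
  have := hf _ kf; rewrite /= {1}kE mdegD mdeg1 add1n => -[] //.
under [RHS]eq_bigr do rewrite mulrDr.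
rewrite big_split /= addrC; congr (_ + _).
rewrite (bigD1 i) //= eqxx scale1r big1 ?addr0 => [|j /negPf ->].
  by rewrite -scalerAr -mpolyXD -kE.
by rewrite scale0r mulr0.
Qed.

Lemma homog1E f : f \is 1.-homog -> f = \sum_i f@_U_(i) *: 'X_i.
Proof.
case/homogSE => q hq ->.
rewrite [LHS](eq_bigr (fun i => (q i)@_0 *: 'X_i)); last first.
  by move=> i _; rewrite {1}(homog0C (hq i)) mulrC mul_mpolyC.
apply: eq_bigr => i _; congr (_ *: _); rewrite raddf_sum (bigD1 i) //= big1 ?addr0.
  by rewrite {2}(homog0C (hq i)) mulrC mul_mpolyC mcoeffZ mcoeffX eqxx mulr1.
move=> j ji; rewrite (homog0C (hq j)) mulrC mul_mpolyC mcoeffZ mcoeffX.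
suff -> : (U_(j) == U_(i))%MM = false by rewrite mulr0.
by apply/negbTE; apply: contra ji => /eqP /mnmP /(_ i); rewrite !mnm1E eqxx; case: eqP.
Qed.

End Homog.

(** * Syzygies of quadrics *)

Section Prime.
Variables (K : fieldType) (m : nat).
Implicit Types (f g a u v w : {mpoly K[m]}).

(* Eliminating a variable occurring in [w] is a ring morphism which kills [w]
   and moves every linear form by a multiple of [w]. *)
Lemma linear_dvd_mul w g h A : w \is 1.-homog -> g \is 1.-homog -> h \is 1.-homog ->
  w != 0 -> g * h = w * A -> (exists x : K, g = x *: w) \/ (exists x : K, h = x *: w).
Proof.
move=> hw hg hh w0 ghE.
have [k wk] : exists k, (w@_U_(k)) != 0.
  apply/existsP; apply: contraNT w0; rewrite negb_exists => /forallP wk.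
  rewrite (homog1E hw) big1 // => i _; have := wk i; rewrite negbK => /eqP ->.
  by rewrite scale0r.
pose th := [tuple 'X_i - (i == k)%:R *: ((w@_U_(k))^-1 *: w) | i < m].
have thE f : f \is 1.-homog -> f \mPo th = f - ((f@_U_(k)) / (w@_U_(k))) *: w.
  move=> hf; rewrite {1 2}(homog1E hf) raddf_sum /=.
  under eq_bigr do rewrite comp_mpolyZ comp_mpolyXU -tnth_nth tnth_mktuple scalerBr.
  rewrite big_split /=; congr (_ + _).
  rewrite (bigD1 k) //= eqxx scale1r big1 ?addr0 => [|i /negPf ->].
    by rewrite scalerA.
  by rewrite scale0r scaler0 oppr0.
(* The image of [w * A] vanishes, so that of [g] or of [h] does too, polynomials forming a
   domain. *)
have /eqP := congr1 (comp_mpoly th) ghE.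
rewrite !rmorphM /= (thE g) // (thE h) // (thE w) // divff // scale1r subrr mul0r mulf_eq0 !subr_eq0.
by case/orP=> /eqP e; [left|right]; rewrite e; eexists.
Qed.
End Prime.

Section Quadrics.
Variables (K : fieldType) (m : nat) (gens : seq {mpoly K[m]}).
Hypothesis quad : forall q, q \in gens -> q \is 2.-homog.
Hypothesis reg : regular_seq gens.
Implicit Types (f g a b u v w z : {mpoly K[m]}).

Lemma linear_in_ideal a : a \is 1.-homog -> in_ideal gens a -> a = 0.
Proof. by move=> ha; apply: (in_ideal_low quad _ ha). Qed.

(** The coefficients of a syzygy lie in an ideal generated in degree 2. *)
Lemma linear_syzygy (c : 'I_(size gens) -> {mpoly K[m]}) :
  (forall i, c i \is 1.-homog) -> \sum_(i < size gens) c i * gens`_i = 0 ->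
  forall i, c i = 0.
Proof.
by move=> hc /(regular_seq_syzygy reg) h i; apply: linear_in_ideal.
Qed.

Lemma quadric_in_ideal u : u \is 2.-homog -> in_ideal gens u ->
  exists c : 'I_(size gens) -> K, u = \sum_(i < size gens) c i *: gens`_i.
Proof.
move=> hu /(in_ideal_homog (e := 2) (d := 0) quad hu)[c hc ->].
exists (fun i => (c i)@_0); apply: eq_bigr => i _.
by rewrite {1}(homog0C (hc i)) mul_mpolyC.
Qed.

(** * The colon of the ideal by [z] *)

Section Colon.
Variables (z w : {mpoly K[m]}) (c : 'I_(size gens) -> K) (p : 'I_(size gens)).
Hypotheses (hz : z \is 1.-homog) (hw : w \is 1.-homog).
Hypotheses (zwE : z * w = \sum_(i < size gens) c i *: gens`_i) (cp : c p != 0).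

(* If [z u = \sum_i A_i f_i], then [c_i u - w A_i] is a syzygy. *)
Lemma colon_linear d u : u \is d.+1.-homog -> in_ideal gens (z * u) ->
  exists2 h, h \is d.-homog & in_ideal gens (u - w * h).
Proof.
move=> hu zu; have hzu : z * u \is (d + 2)%N.-homog.
  by rewrite addn2; exact: (dhomogM hz hu).
have [A hA zuE] := in_ideal_homog quad hzu zu.
exists ((c p)^-1 *: A p); first exact/rpredZ/hA.
have /regular_seq_syzygy-/(_ reg p) :
    \sum_(i < size gens) (c i *: u - w * A i) * gens`_i = 0.
  under eq_bigr do rewrite mulrBl -scalerAl scalerAr -!mulrA.
  rewrite sumrB -!mulr_sumr -zwE -zuE; ring.
move=> h; apply: (in_idealZ cp).
by rewrite scalerBr -scalerAr scalerA divff // scale1r.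
Qed.

(** The relation [zwE] trades the generator [f_p] for [z w] and the other generators, which adds a
    multiple of [z] to [h]. The normalization [e p = 0] clears index [p] of a syzygy in
    [kernel_mul_linear]. *)
Lemma colon_linear2 u : u \is 2.-homog -> in_ideal gens (z * u) ->
  exists h (e : 'I_(size gens) -> K), [/\ h \is 1.-homog, e p = 0 &
    u = w * h + \sum_(i < size gens) e i *: gens`_i].
Proof.
move=> hu /(colon_linear hu)[h hh].
case/quadric_in_ideal => [|e /eqP]; first by rewrite rpredB // (@dhomogM _ _ _ 1 _ 1).
rewrite subr_eq => /eqP ->.
exists (h + (e p / c p) *: z), (fun i => e i - e p / c p * c i); split.
- by rewrite rpredD // rpredZ.
- by rewrite divfK ?subrr.
under [in RHS]eq_bigr do rewrite scalerBl -scalerA.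
by rewrite sumrB -scaler_sumr -zwE -!mul_mpolyC; ring.
Qed.

(** Write [g h = w A + qa] and [g a = w B + qb]. Eliminating [g] gives
    [w (h B - a A) = a qa - h qb]; multiplied by [z], this is a syzygy whose entry at [p] puts
    [h B - a A] in the ideal. What remains is a linear syzygy, whose vanishing relates [a], [h] and
    [w]. *)
Lemma kernel_mul_linear g h a :
  g \is 1.-homog -> h \is 1.-homog -> a \is 1.-homog ->
  ~ in_ideal gens (z * g) -> ~ in_ideal gens (z * h) ->
  in_ideal gens (z * (g * h)) -> in_ideal gens (z * (g * a)) ->
  exists x y : K, a = x *: h + y *: w.
Proof.
move=> hg hh ha zg zh zgh zga.
have zw : in_ideal gens (z * w).
  by rewrite zwE; exists (fun i => (c i)%:MP); apply: eq_bigr => i _; rewrite mul_mpolyC.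
have [A [al [hA alp ghE]]] := colon_linear2 (dhomogM hg hh : _ \is 2.-homog) zgh.
have [B [be [hB bep gaE]]] := colon_linear2 (dhomogM hg ha : _ \is 2.-homog) zga.
set qa := \sum_(i < _) _ in ghE; set qb := \sum_(i < _) _ in gaE.
have wE : w * (h * B - a * A) = a * qa - h * qb.
  have -> : qa = g * h - w * A by rewrite ghE; ring.
  have -> : qb = g * a - w * B by rewrite gaE; ring.
  ring.
have /regular_seq_syzygy-/(_ reg p) : \sum_(i < size gens)
    (c i *: (h * B - a * A) - z * (al i *: a - be i *: h)) * gens`_i = 0.
  have -> : \sum_(i < size gens)
    (c i *: (h * B - a * A) - z * (al i *: a - be i *: h)) * gens`_i =
    (\sum_(i < size gens) c i *: gens`_i) * (h * B - a * A) - z * (a * qa - h * qb).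
    rewrite mulr_suml !mulr_sumr -sumrB mulr_sumr -sumrB; apply: eq_bigr => i _.
    rewrite -!mul_mpolyC; ring.
  by rewrite -zwE -wE; ring.
rewrite alp bep !scale0r subrr mulr0 subr0 => /(in_idealZ cp).
case/quadric_in_ideal => [|ga gaE'].
  by rewrite rpredB // (@dhomogM _ _ _ 1 _ 1).
(* Substituting [gaE'] in [wE] yields a syzygy with linear coefficients. *)
have lin i : ga i *: w - (al i *: a - be i *: h) = 0.
  apply: (linear_syzygy (c := fun i => ga i *: w - (al i *: a - be i *: h))) i.
    by move=> i; rewrite !(rpredB, rpredZ).
  transitivity (w * (h * B - a * A) - (a * qa - h * qb)); last by rewrite wE subrr.
  rewrite gaE' /qa /qb !mulr_sumr -!sumrB; apply: eq_bigr => i _.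
  rewrite -!mul_mpolyC; ring.
have [i ali|al0] := pickP (fun i => al i != 0).
  exists ((al i)^-1 * be i), ((al i)^-1 * ga i); apply: (scalerI ali).
  rewrite scalerDr !scalerA !mulrA divff // !mul1r.
  apply/eqP; rewrite -subr_eq0 -oppr_eq0; apply/eqP; rewrite -[RHS](lin i).
  by rewrite -!mul_mpolyC; ring.
(* In the remaining case [g h = w A], so [g] or [h] is a multiple of [w], against [zg] or [zh]. *)
have qa0 : qa = 0.
  by rewrite /qa big1 // => i _; have /negbFE/eqP -> := al0 i; rewrite scale0r.
(* If [w = 0], the constants [c i] form a syzygy, although [c p] is a unit. *)
have w0 : w != 0.
  apply/eqP => w0; have /regular_seq_syzygy-/(_ reg p) :
    \sum_(i < size gens) (c i)%:MP * gens`_i = 0.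
    by under eq_bigr do rewrite mul_mpolyC; rewrite -zwE w0 mulr0.
  have hc : mpolyC m (c p) \is 0.-homog.
    by rewrite -alg_mpolyC; apply/rpredZ/dhomog1.
  move=> /(in_ideal_low quad (isT : (0 < 2)%N) hc) /eqP.
  by rewrite mpolyC_eq0 (negPf cp).
move: ghE; rewrite qa0 addr0 => /(linear_dvd_mul hw hg hh w0)[[x e]|[x e]].
  by case: zg; rewrite e -scalerAr -mul_mpolyC; apply: in_idealM.
by case: zh; rewrite e -scalerAr -mul_mpolyC; apply: in_idealM.
Qed.
End Colon.
End Quadrics.

(** * Pencils of linear maps *)

Section Pencil.
Import VectorInternalTheory.
Variable K : fieldType.

(** With [D] a right inverse of the matrix at [t0], take [p] to be the determinant of [(A + t B) D];
    its value at [t0] is 1. *)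
Lemma row_free_pencil m n (A B : 'M[K]_(m, n)) t0 : row_free (A + t0 *: B) ->
  exists2 p : {poly K}, p != 0 & forall t, p.[t] != 0 -> row_free (A + t *: B).
Proof.
set D := pinvmx (A + t0 *: B) => /mulmxVp DK.
pose p := \det (map_mx polyC (A *m D) + 'X *: map_mx polyC (B *m D)).
have pE t : p.[t] = \det ((A + t *: B) *m D).
  rewrite -[p.[t]]/(horner_eval t p) -det_map_mx; congr (\det _).
  rewrite mulmxDl -scalemxAl; move: (A *m D) (B *m D) => a b.
  by apply/matrixP=> i j; rewrite !mxE /= /horner_eval !hornerE.
exists p => [|t].
  by apply/eqP=> p0; have /eqP := pE t0; rewrite p0 horner0 DK det1 eq_sym oner_eq0.
rewrite pE -unitfE -unitmxE => u; rewrite -row_leq_rank -{1}(mxrank_unit u).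
exact: mxrankM_maxl.
Qed.

Variables V W : vectType K.
Implicit Types (f g : 'Hom(V, W)) (Y : {vspace V}) (U : {vspace W}).

Lemma mem_projv_eq0 U v : (v \in U) = (v - projv U v == 0).
Proof.
apply/idP/eqP => [/projv_id ->|/eqP]; first by rewrite subrr.
by rewrite subr_eq0 => /eqP ->; exact: memv_proj.
Qed.

Lemma memvZl (V' : vectType K) (U' : {vspace V'}) a (v : V') : a != 0 ->
  (a *: v \in U') = (v \in U').
Proof. by move=> /negPf a0; rewrite rpredZeq a0. Qed.

(** This is openness of injectivity for the induced maps from [V / Y] to [W / U]. The complement
    [Y^C] stands for [V / Y], and [k], whose kernel is [U], for the projection to [W / U]. *)
Lemma pencil_open f g Y U t0 : (f @: Y <= U)%VS -> (g @: Y <= U)%VS ->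
  (forall v, f v + t0 *: g v \in U -> v \in Y) ->
  exists2 p : {poly K}, p != 0 &
    forall t, p.[t] != 0 -> forall v, f v + t *: g v \in U -> v \in Y.
Proof.
move=> /subvP fY /subvP gY inj.
pose e := vbasis Y^C; pose k w := w - projv U w.
have kE t x : k (f x + t *: g x) = k (f x) + t *: k (g x).
  by rewrite /k linearD linearZ opprD addrACA scalerBr.
have ksum (h : 'Hom(V, W)) (x : 'rV_(\dim Y^C)) :
    k (h (\sum_i x 0 i *: e`_i)) = \sum_i x 0 i *: k (h e`_i).
  rewrite /k linear_sum /= linear_sum /= -sumrB; apply: eq_bigr => i _.
  by rewrite scalerBr !linearZ.
have kU v : (v \in U) = (k v == 0) by exact: mem_projv_eq0.
clearbody k.
pose A := \matrix_(i < \dim Y^C) v2r (k (f e`_i)).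
pose B := \matrix_(i < \dim Y^C) v2r (k (g e`_i)).
have comb t (x : 'rV_(\dim Y^C)) (v := \sum_i x 0 i *: e`_i) :
    x *m (A + t *: B) = v2r (k (f v + t *: g v)).
  rewrite kE !ksum scaler_sumr -big_split linear_sum mulmx_sum_row.
  apply: eq_bigr => i _ /=.
  have -> : row i (A + t *: B) = v2r (k (f e`_i)) + t *: v2r (k (g e`_i)).
    by apply/rowP => j; rewrite !mxE.
  by rewrite scalerDr linearD !linearZ /= !scalerA ?[t * _]mulrC.
have vC (x : 'rV_(\dim Y^C)) : \sum_i x 0 i *: e`_i \in (Y^C)%VS.
  by apply: memv_suml => i _; apply: memvZ; apply: vbasis_mem; rewrite mem_nth ?size_tuple.
have inC v : v \in Y -> v \in (Y^C)%VS -> v = 0.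
  by move=> vY vC'; apply/eqP; rewrite -memv0 -(capv_compl Y) memv_cap vY.
have x0 (x : 'rV_(\dim Y^C)) : \sum_i x 0 i *: e`_i = 0 -> x = 0.
  move=> s0; apply/rowP => i; rewrite mxE.
  by have /freeP := basis_free (vbasisP Y^C); apply.
have [|p p0 hp] := @row_free_pencil _ _ A B t0.
  apply: inj_row_free => x; rewrite comb => /(congr1 r2v); rewrite v2rK linear0.
  move=> /eqP; rewrite -kU => /inj hY.
  exact/x0/inC/vC.
exists p => // t /hp/row_free_inj free v hv.
have yY := memv_proj Y v; set y := projv Y v in yY.
have := memv_projC Y v; rewrite -/y => cC.
have cU : k (f (v - y) + t *: g (v - y)) = 0.
  apply/eqP; rewrite -kU.
  have -> : f (v - y) + t *: g (v - y) = f v + t *: g v - (f y + t *: g y).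
    by rewrite (linearB f) (linearB g) /= scalerBr opprD addrACA.
  rewrite rpredB //.
  apply: rpredD; first exact/fY/memv_img.
  exact/rpredZ/gY/memv_img.
have cE := coord_vbasis cC.
have /free x00 : (\row_i coord e i (v - y)) *m (A + t *: B) = 0 *m (A + t *: B).
  have sE : \sum_i (\row_i coord e i (v - y)) 0 i *: e`_i = v - y.
    by rewrite [RHS]cE; apply: eq_bigr => i _; rewrite mxE.
  by rewrite mul0mx comb sE cU linear0.
suff : v - y = 0 by move/eqP; rewrite subr_eq0 => /eqP ->.
rewrite cE big1 // => i _.
by have /rowP/(_ i) := x00; rewrite !mxE => ->; rewrite scale0r.
Qed.

(* When [f] has a kernel line [g0] modulo [Y], replacing [f g0] by [g g0]
   makes the pencil injective at [t = 0] without changing it elsewhere. *)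
Lemma pencil_open_tangent f g Y U (g0 : V) : (f @: Y <= U)%VS -> (g @: Y <= U)%VS ->
  f g0 \in U -> (forall v, f v \in U -> v \in (Y + <[g0]>)%VS) ->
  (forall v, g g0 + f v \notin U) ->
  exists2 p : {poly K}, p != 0 & forall t, t != 0 -> p.[t] != 0 ->
    forall v, f v + t *: g v \in U -> v \in Y.
Proof.
move=> fY gY fg0 ker ntan.
have g0Y : g0 \notin Y.
  apply: contra (ntan 0) => g0Y; rewrite linear0 addr0.
  by apply: (subvP gY); exact: memv_img.
(* A complement of the line of [g0] that contains [Y]; [pi] below projects onto the line along
   it. *)
pose Z := (Y + (Y + <[g0]>)^C)%VS.
have g0Z : (<[g0]> :&: Z = 0)%VS.
  apply/eqP; rewrite -subv0; apply/subvP => v; rewrite memv_cap => /andP[/vlineP[a ->]].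
  case/memv_addP => y yY [c cC e].
  have c0 : c = 0.
    apply/eqP; rewrite -memv0 -(capv_compl (Y + <[g0]>)) memv_cap cC andbT.
    have -> : c = - y + a *: g0 by rewrite e addKr.
    by rewrite memv_add ?rpredN // memvZ // memv_line.
  move: e; rewrite c0 addr0 memv0 scaler_eq0 => e.
  have [//|a0] := eqVneq a 0; case/negP: g0Y.
  by rewrite -(memvZl _ _ a0) e.
pose pi := daddv_pi <[g0]> Z.
have piE v : exists a, pi v = a *: g0 by apply/vlineP; exact: memv_pi.
have pi_g0 : pi g0 = g0 by rewrite daddv_pi_id // memv_line.
have piY y : y \in Y -> pi y = 0.
  move=> yY; have yZ : y \in Z by rewrite -[y]addr0 memv_add // mem0v.
  have yS : y \in (<[g0]> + Z)%VS by apply: (subvP (addvSr _ _)).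
  have := daddv_pi_add g0Z yS; rewrite (daddv_pi_id _ yZ) ?[(Z :&: _)%VS]capvC //.
  by move/eqP; rewrite eq_sym -subr_eq subrr eq_sym => /eqP.
have pi_pi v : pi (pi v) = pi v by have [a ->] := piE v; rewrite linearZ /= pi_g0.
(* Modulo [U], and for [t] nonzero, [f' + t g'] is [f + t g] after division of the component along
   [g0] by [t]. *)
pose f' := ((f \o (\1 - pi)) + (g \o pi))%VF; pose g' := (g \o (\1 - pi))%VF.
have f'E v : f' v = f (v - pi v) + g (pi v).
  by rewrite /f' add_lfunE !comp_lfunE add_lfunE opp_lfunE id_lfunE.
have g'E v : g' v = g (v - pi v).
  by rewrite /g' comp_lfunE add_lfunE opp_lfunE id_lfunE.
have [|||p p0 hp] := @pencil_open f' g' Y U 0.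
- apply/subvP => _ /memv_imgP[y yY ->]; rewrite f'E piY // subr0 linear0 addr0.
  by apply: (subvP fY); exact: memv_img.
- apply/subvP => _ /memv_imgP[y yY ->]; rewrite g'E piY // subr0.
  by apply: (subvP gY); exact: memv_img.
- move=> v; rewrite scale0r addr0 f'E; have [a piv] := piE v; rewrite piv.
  have [a0|a0] := eqVneq a 0.
    rewrite a0 scale0r subr0 linear0 addr0 => /ker/memv_addP[y yY [_ /vlineP[b ->] e]].
    move: piv; rewrite a0 scale0r e linearD linearZ /= pi_g0 piY // add0r => ->.
    by rewrite addr0.
  have fE : f (a^-1 *: (v - a *: g0)) = a^-1 *: f (v - a *: g0) by exact: linearZ.
  have gE : g (a *: g0) = a *: g g0 by exact: linearZ.
  (* Dividing by [a] gives a solution of the tangent equation excluded by [ntan]. *)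
  move=> hU; case/negP: (ntan (a^-1 *: (v - a *: g0))).
  by rewrite -(memvZl _ _ a0) scalerDr fE scalerA divff // scale1r addrC -gE.
exists p => // t t0 pt v hv.
(* The inverse rescaling carries [v] to a vector that the modified pencil sends into [U]. *)
have TE : pi (v - pi v + t *: pi v) = t *: pi v.
  by rewrite linearD linearB linearZ /= pi_pi subrr add0r.
have TY : v - pi v + t *: pi v \in Y.
  apply: (hp t pt); rewrite f'E g'E TE addrK.
  have [a piv] := piE v.
  have -> : f (v - pi v) + g (t *: pi v) + t *: g (v - pi v) = (f v + t *: g v) - f (pi v).
    rewrite (linearB f) (linearB g) /= scalerBr.
    have -> : g (t *: pi v) = t *: g (pi v) by exact: linearZ.
    by rewrite [t *: g v - _]addrC addrA addrK addrAC.
  by rewrite rpredB // piv linearZ rpredZ.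
have := piY _ TY; rewrite TE => /eqP; rewrite scaler_eq0 (negPf t0) /= => /eqP piv.
by move: TY; rewrite piv subr0 scaler0 addr0.
Qed.
End Pencil.

(** * Graded pieces *)

Section HomogMul.
Variables (K : fieldType) (n : nat).
Local Notation V := (dhomog n.+1 K).

(** With the degree of [q] first, [1 + d] and [2 + d] reduce to [d.+1] and [d.+2], and no casts
    arise. *)
Definition hmul e d (q : V e) (x : V d) : V (e + d) :=
  DHomog (dhomogM (dhomog_is_dhomog q) (dhomog_is_dhomog x)).

Lemma hmul_is_linear e d (q : V e) : linear (hmul (d := d) q).
Proof. by move=> a x y; apply: val_inj; rewrite /= mulrDr -scalerAr. Qed.

HB.instance Definition _ e d (q : V e) :=
  GRing.isLinear.Build K (V d) (V (e + d)) _ (hmul q) (hmul_is_linear q).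

Definition mul1 d (l : V 1) : 'Hom(V d, V d.+1) := linfun (hmul l).

Lemma mul1E d l (x : V d) : val (mul1 d l x) = val l * val x.
Proof. exact: (congr1 val (lfunE (@hmul 1 d l) x)). Qed.

Lemma lker_mul1 d (l : V 1) : l != 0 -> lker (mul1 d l) = 0%VS.
Proof.
move=> l0; apply/eqP; rewrite -subv0; apply/subvP => x; rewrite memv_ker memv0.
move=> /eqP/(congr1 val)/eqP; rewrite mul1E /= mulf_eq0 => /orP[] /eqP e.
  by case/eqP: l0; apply: val_inj.
by apply/eqP/val_inj.
Qed.

Lemma dim_dhomog d : \dim {: V d} = 'C(d + n, d).
Proof. by rewrite dimvf. Qed.

Variable gens : seq {mpoly K[n.+1]}.
Hypothesis quad : forall q, q \in gens -> q \is 2.-homog.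

Definition quadric (i : 'I_(size gens)) : V 2 := DHomog (quad (mem_nth 0 (ltn_ord i))).

Definition comb d (c : {ffun 'I_(size gens) -> V d}) : V d.+2 :=
  \sum_i hmul (quadric i) (c i).

Lemma comb_is_linear d : linear (@comb d).
Proof.
move=> a x y; rewrite /comb scaler_sumr -big_split; apply: eq_bigr => i _.
by rewrite !ffunE linearP.
Qed.

HB.instance Definition _ d :=
  GRing.isLinear.Build K {ffun 'I_(size gens) -> V d} (V d.+2) _ (@comb d) (@comb_is_linear d).

Lemma combE d c : @comb d c = \sum_i val (c i) * gens`_i :> {mpoly K[n.+1]}.
Proof.
rewrite /comb -[LHS]/(val _) raddf_sum; apply: eq_bigr => i _.
by rewrite /= mulrC.
Qed.

(** The index is shifted by 2, the degree of the generators: this is the piece of degree [d.+2]. *)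
Definition ideal_part d : {vspace V d.+2} := limg (linfun (@comb d)).

Lemma mem_ideal_part d (u : V d.+2) : u \in ideal_part d <-> in_ideal gens u.
Proof.
split=> [/memv_imgP[c _ ->]|].
  by rewrite lfunE /= combE; eexists.
have hu : val u \is (d + 2)%N.-homog by rewrite addn2; exact: dhomog_is_dhomog.
case/(in_ideal_homog quad hu) => c hc uE; apply/memv_imgP.
exists [ffun i => DHomog (hc i)]; first by rewrite memvf.
apply: val_inj; rewrite lfunE /= combE uE.
by apply: eq_bigr => i _; rewrite ffunE.
Qed.

Hypothesis reg : regular_seq gens.
Hypothesis sz : size gens = n.+1.

(** The map [comb] is injective: a syzygy has its coefficients in the ideal, which has no nonzero
    form of degree below 2. *)
Lemma dim_ideal_part d : (d < 2)%N -> \dim (ideal_part d) = (n.+1 * 'C(d + n, d))%N.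
Proof.
move=> d2; rewrite limg_dim_eq ?dimvf.
  by transitivity (#|'I_(size gens)| * 'C(d + n, d))%N; [|rewrite card_ord sz].
apply/eqP; rewrite -subv0; apply/subvP => c; rewrite memv_cap memv_ker memv0 lfunE.
move=> /andP[_ /eqP/(congr1 val)]; rewrite /= combE => /(regular_seq_syzygy reg) h.
apply/eqP/ffunP => i; apply: val_inj; rewrite ffunE /=.
exact: (in_ideal_low quad d2 (dhomog_is_dhomog (c i)) (h i)).
Qed.

End HomogMul.

(** * Dimensions of the ideal [(z) + I] in degrees 2 and 3 *)

Section Dimensions.
Variables (K : fieldType) (n : nat) (gens : seq {mpoly K[n.+1]}).
Hypothesis quad : forall q, q \in gens -> q \is 2.-homog.
Hypothesis reg : regular_seq gens.
Hypothesis sz : size gens = n.+1.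
Local Notation V := (dhomog n.+1 K).

Lemma val_neq0 d (x : V d) : x != 0 -> val x != 0.
Proof. by apply: contra => /eqP e; apply/eqP/val_inj. Qed.

Lemma linear_mul_combination (z w : V 1) : z != 0 -> w != 0 -> in_ideal gens (val z * val w) ->
  exists (c : 'I_(size gens) -> K) p, c p != 0 /\
    val z * val w = \sum_(i < size gens) c i *: gens`_i.
Proof.
move=> z0 w0 /(quadric_in_ideal quad (dhomogM (dhomog_is_dhomog z) (dhomog_is_dhomog w))).
case=> c zwE; exists c.
have [p cp|c0] := pickP (fun i => c i != 0); first by exists p.
have := mulf_neq0 (val_neq0 z0) (val_neq0 w0); rewrite zwE big1 ?eqxx // => i _.
by have /negbFE/eqP -> := c0 i; rewrite scale0r.
Qed.

(** In [colon_linear] the cofactor [h] has degree 0, hence is a scalar. *)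
Lemma annihilator_linear (z w u : V 1) : z != 0 -> w != 0 ->
  in_ideal gens (val z * val w) -> in_ideal gens (val z * val u) -> u \in <[w]>%VS.
Proof.
move=> z0 w0 zw zu; have [c [p [cp zwE]]] := linear_mul_combination z0 w0 zw.
have [h hh] := colon_linear quad reg (dhomog_is_dhomog z) zwE cp (dhomog_is_dhomog u) zu.
rewrite (homog0C hh) mulrC mul_mpolyC.
have hom : val u - h@_0 *: val w \is 1.-homog.
  exact: (dhomog_is_dhomog (u - h@_0 *: w)).
move=> /(linear_in_ideal quad hom)/eqP; rewrite subr_eq0 => /eqP e.
by apply/vlineP; exists h@_0; apply: val_inj.
Qed.

(** The subspace of forms of degree [d.+2] that is divided out to obtain [R/(z)], not the
    quotient. *)
Definition quotient_part d (z : V 1) : {vspace V d.+2} :=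
  (limg (mul1 d.+1 z) + ideal_part quad d)%VS.

Lemma mem_quotient_part d z (u : V d.+2) : u \in quotient_part d z <->
  exists h : V d.+1, in_ideal gens (val u - val z * val h).
Proof.
split=> [/memv_addP[_ /memv_imgP[h _ ->] [q qI ->]]|[h uI]].
  exists h; rewrite /= mul1E addrAC subrr add0r.
  exact/(mem_ideal_part quad).
rewrite -[u](subrK (mul1 d.+1 z h)) addrC; apply: memv_add.
  exact/memv_img/memvf.
by apply/mem_ideal_part; rewrite /= mul1E.
Qed.

Lemma mem_ideal_rcons d (z : V 1) (u : V d.+2) :
  u \in quotient_part d z <-> in_ideal (rcons gens (val z)) (val u).
Proof.
split=> [/mem_quotient_part[h uI]|/in_ideal_rcons[h [c uE]]].
  by apply/in_ideal_rcons; exists (val h).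
(* The cofactor [h] need not be homogeneous; its component of degree [d.+1] is the one that
   counts. *)
apply/mem_quotient_part; exists (DHomog (pihomogP mdeg d.+1 h)) => /=.
exists (fun i => pihomog mdeg d (c i)).
have /(congr1 (pihomog mdeg d.+2)) := uE.
rewrite pihomogB [RHS]raddf_sum (pihomog_dE (dhomog_is_dhomog u)) => e.
have -> : val z * pihomog mdeg d.+1 h = pihomog mdeg d.+2 (val z * h).
  by rewrite ![val z * _]mulrC -(pihomogM d.+1 h (dhomog_is_dhomog z)) addn1.
rewrite e; apply: eq_bigr => i _ /=.
by rewrite -addn2 pihomogM // quad // mem_nth.
Qed.

Lemma mul1_quotient_part d (z l : V 1) :
  (mul1 d.+2 l @: quotient_part d z <= quotient_part d.+1 z)%VS.
Proof.
apply/subvP => _ /memv_imgP[u /mem_quotient_part[h uI] ->]; apply/mem_quotient_part.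
exists (mul1 d.+1 l h); rewrite !mul1E mulrCA -mulrBr; exact: in_idealM.
Qed.

Lemma dim_limg_mul1 d (z : V 1) (A : {vspace V d}) : z != 0 ->
  \dim (mul1 d z @: A) = \dim A.
Proof. by move=> z0; rewrite limg_dim_eq ?lker_mul1 ?capv0. Qed.

(** Both summands have dimension [n + 1], and they meet at most in the line of [z w]. *)
Lemma dim_quotient_part0 (z w : V 1) : z != 0 -> w != 0 ->
  in_ideal gens (val z * val w) -> (2 * n + 1 <= \dim (quotient_part 0 z))%N.
Proof.
move=> z0 w0 zw; have := dimv_sum_cap (limg (mul1 1 z)) (ideal_part quad 0).
rewrite -/(quotient_part 0 z) dim_limg_mul1 // dim_dhomog dim_ideal_part // bin0 bin1.
suff : (\dim (limg (mul1 1 z) :&: ideal_part quad 0) <= 1)%N.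
  by move: (\dim (quotient_part 0 z)) (\dim (_ :&: _)) => a b; lia.
apply: (@leq_trans (\dim <[mul1 1 z w]>)); last by rewrite dim_vline leq_b1.
apply/dimvS/subvP => _ /memv_capP[/memv_imgP[u _ ->] /mem_ideal_part].
rewrite mul1E => /(annihilator_linear z0 w0 zw)/vlineP[a ->].
by rewrite linearZ memvZ // memv_line.
Qed.

(** Since [z w] is in [I], the two summands share [z] times the quadrics of [(w) + I], a space of
    dimension at least [2n + 1]. *)
Lemma dim_quotient_part1 (z w : V 1) : z != 0 -> w != 0 ->
  in_ideal gens (val z * val w) ->
  (\dim (quotient_part 1 z) + (2 * n + 1) <= 'C(2 + n, 2) + n.+1 * n.+1)%N.
Proof.
move=> z0 w0 zw; have := dimv_sum_cap (limg (mul1 2 z)) (ideal_part quad 1).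
rewrite -/(quotient_part 1 z) dim_limg_mul1 // dim_dhomog dim_ideal_part // bin1 add1n.
move=> <-; rewrite leq_add2l.
have wz : in_ideal gens (val w * val z) by rewrite mulrC.
apply: (leq_trans (dim_quotient_part0 w0 z0 wz)).
rewrite -(dim_limg_mul1 _ z0); apply/dimvS; rewrite subv_cap limgS ?subvf //=.
apply/subvP => _ /memv_imgP[u /mem_quotient_part[h uI] ->]; apply/mem_ideal_part.
rewrite mul1E -[val u](subrK (val w * val h)) mulrDr.
apply: in_idealD; first exact: in_idealM.
by rewrite mulrA mulrC; apply: in_idealM.
Qed.

Lemma bin2_mul2 k : ('C(k.+2, 2) * 2 = k.+2 * k.+1)%N.
Proof. by rewrite -[2%N in LHS]/(2`!) bin_ffact ffactnS ffactn1. Qed.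

Lemma bin3_mul6 k : ('C(k.+3, 3) * 6 = k.+3 * (k.+2 * k.+1))%N.
Proof. by rewrite -[6%N]/(3`!) bin_ffact !ffactnS ffactn0 muln1. Qed.

(** Equivalently [C2 - (2n + 1) <= C3 - C2 - n^2]: the sides bound the pieces of [R/(z)] in degree 2
    from above and in degree 3 from below. *)
Lemma bin23_leq : (5 <= n)%N -> (2 * 'C(n.+2, 2) + n * n <= 'C(n.+3, 3) + 2 * n + 1)%N.
Proof.
move=> n5; have := bin2_mul2 n; have := bin3_mul6 n.
move: 'C(n.+2, 2) 'C(n.+3, 3) => C2 C3; rewrite -(subnKC n5).
move: (n - 5)%N => k; nia.
Qed.

Hypothesis n5 : (5 <= n)%N.

Lemma cubics_not_quotient_part (z w : V 1) : z != 0 -> w != 0 ->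
  in_ideal gens (val z * val w) -> quotient_part 1 z != fullv.
Proof.
move=> z0 w0 zw; apply/eqP => full.
have := dim_quotient_part1 z0 w0 zw; rewrite full dim_dhomog !addSn !add0n.
have := bin2_mul2 n; have := bin3_mul6 n; nia.
Qed.

(* This is [dim (R/(z))_2 <= dim (R/(z))_3], where equality holds for [n = 5]. *)
Lemma quotient_surj_inj (z w l : V 1) : z != 0 -> w != 0 ->
  in_ideal gens (val z * val w) ->
  (limg (mul1 2 l) + quotient_part 1 z)%VS = fullv ->
  forall f : V 2, mul1 2 l f \in quotient_part 1 z -> f \in quotient_part 0 z.
Proof.
move=> z0 w0 zw surj.
have l0 : l != 0.
  apply: contraNneq (cubics_not_quotient_part z0 w0 zw) => l0.
  rewrite -surj; have -> : limg (mul1 2 l) = 0%VS.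
    apply/eqP; rewrite -subv0; apply/subvP => _ /memv_imgP[u _ ->].
    by rewrite memv0; apply/eqP/val_inj; rewrite mul1E l0 /= mul0r.
  by rewrite add0v.
have sub : (mul1 2 l @: quotient_part 0 z <= limg (mul1 2 l) :&: quotient_part 1 z)%VS.
  by rewrite subv_cap limgS ?subvf //= mul1_quotient_part.
(* By surjectivity the right side has dimension at most [2 C2 + n^2 - C3], hence at most [2n + 1],
   which bounds the left side from below. *)
have eqU : (mul1 2 l @: quotient_part 0 z == limg (mul1 2 l) :&: quotient_part 1 z)%VS.
  rewrite eqEdim sub dim_limg_mul1 //=.
  have := dimv_sum_cap (limg (mul1 2 l)) (quotient_part 1 z).
  rewrite surj dim_limg_mul1 // !dim_dhomog.
  have := dim_quotient_part1 z0 w0 zw; have := dim_quotient_part0 z0 w0 zw.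
  have := bin23_leq n5; rewrite !addSn !add0n.
  move: (\dim (quotient_part 0 z)) (\dim (quotient_part 1 z)) (\dim (_ :&: _)).
  by move: ('C(n.+2, 2)) ('C(n.+3, 3)) => C2 C3 a b c; lia.
move=> f fU; have : mul1 2 l f \in (limg (mul1 2 l) :&: quotient_part 1 z)%VS.
  by rewrite memv_cap fU andbT memv_img ?memvf.
rewrite -(eqP eqU) => /memv_imgP[u uU e].
by have /eqP/lker0P inj := lker_mul1 2 l0; rewrite (inj _ _ e).
Qed.

End Dimensions.

(** * Generic linear forms *)

Section Lefschetz.
Variables (K : closedFieldType) (n : nat) (gens : seq {mpoly K[n.+1]}).
Hypothesis quad : forall q, q \in gens -> q \is 2.-homog.
Hypothesis reg : regular_seq gens.
Hypothesis sz : size gens = n.+1.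
Hypothesis n5 : (5 <= n)%N.
Hypothesis two0 : (2%:R : K) != 0.
Local Notation V := (dhomog n.+1 K).
Local Notation I := (in_ideal gens).
Implicit Types l g h u v : V 1.

Lemma mul1DZ d l h t (x : V d) : mul1 d (l + t *: h) x = mul1 d l x + t *: mul1 d h x.
Proof. by apply: val_inj; rewrite /= !mul1E /= mulrDl scalerAl. Qed.

Variables z w : V 1.
Hypotheses (z0 : z != 0) (w0 : w != 0) (zw : I (val z * val w)).

(** Thus [z R^1] is [S_1] modulo the line of [w], and that line serves as [Y] in the pencil
    lemmas. *)
Lemma linear_annihilatorP g : I (val z * val g) <-> g \in <[w]>%VS.
Proof.
split; first exact: annihilator_linear.
by case/vlineP => a ->; rewrite /= -scalerAr -mul_mpolyC; apply: in_idealM.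
Qed.

(** Injectivity of [l] on the degree 2 piece of the ideal [zR]. *)
Definition injective_on_z l :=
  forall g, I (val z * (val l * val g)) -> I (val z * val g).

Lemma mul1_mul1_ideal l g :
  (mul1 2 z \o mul1 1 l)%VF g \in ideal_part quad 1 <-> I (val z * (val l * val g)).
Proof.
rewrite comp_lfunE; split => [/mem_ideal_part|]; rewrite ?mul1E //.
by move=> h; apply/mem_ideal_part; rewrite !mul1E.
Qed.

Lemma mul1_mul1_line l : ((mul1 2 z \o mul1 1 l)%VF @: <[w]> <= ideal_part quad 1)%VS.
Proof.
apply/subvP => _ /memv_imgP[u /linear_annihilatorP hu ->].
by apply/mul1_mul1_ideal; rewrite mulrCA; apply: in_idealM.
Qed.

Lemma mul1_mul1DZ l h t g : (mul1 2 z \o mul1 1 (l + t *: h))%VF g =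
  (mul1 2 z \o mul1 1 l)%VF g + t *: (mul1 2 z \o mul1 1 h)%VF g.
Proof. by rewrite !comp_lfunE mul1DZ linearD linearZ. Qed.

(* If [z h g = 0] and every [h + t m] is degenerate, the tangent equation
   [z (m g + h v) = 0] has a solution [v]; multiply it by [g]. *)
Lemma square_mul_ideal : ~ (exists l, injective_on_z l) ->
  forall g m : V 1, I (val z * (val m * (val g * val g))).
Proof.
move=> ninj g m.
have bad l : exists h, I (val z * (val l * val h)) /\ ~ I (val z * val h).
  apply: NNPP => no; apply: ninj; exists l => h lh.
  by apply: NNPP => nh; apply: no; exists h.
have [zg|zg] := classic (I (val z * val g)).
  have -> : val z * (val m * (val g * val g)) = (val m * val g) * (val z * val g) by ring.
  exact: in_idealM.
have [h [zgh zh]] := bad g.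
have zhg : I (val z * (val h * val g)) by rewrite [val h * _]mulrC.
have [[v zv]|nov] := classic (exists v, I (val z * (val m * val g + val h * val v))).
  have -> : val z * (val m * (val g * val g)) =
      val g * (val z * (val m * val g + val h * val v)) - val v * (val z * (val h * val g)).
    by ring.
  by apply: in_idealB; apply: in_idealM.
have [c [p [cp zwE]]] := linear_mul_combination quad z0 w0 zw.
have [|||||q q0 hq] := @pencil_open_tangent _ _ _ (mul1 2 z \o mul1 1 h)%VF
    (mul1 2 z \o mul1 1 m)%VF <[w]>%VS (ideal_part quad 1) g.
- exact: mul1_mul1_line.
- exact: mul1_mul1_line.
- exact/mul1_mul1_ideal.
(* Here [h] is the multiplier in [kernel_mul_linear], and [g] the known element of its kernel. *)
- move=> v /mul1_mul1_ideal zv.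
  have [x [y e]] := kernel_mul_linear quad reg (dhomog_is_dhomog z) (dhomog_is_dhomog w)
    zwE cp (dhomog_is_dhomog h) (dhomog_is_dhomog g) (dhomog_is_dhomog v) zh zg zhg zv.
  have -> : v = y *: w + x *: g by apply: val_inj; rewrite /= e addrC.
  by rewrite memv_add ?memvZ ?memv_line.
- move=> v; apply/negP; rewrite !comp_lfunE -linearD => /mem_ideal_part.
  by rewrite mul1E /= !mul1E => zv; apply: nov; exists v.
(* The factor ['X] keeps [t] away from 0, where [h] itself is degenerate. *)
have /closed_nonrootP[t] : q * 'X != 0 by rewrite mulf_neq0 ?polyX_eq0.
rewrite rootM rootX negb_or => /andP[qt t0]; case: ninj; exists (h + t *: m) => v.
move=> /mul1_mul1_ideal; rewrite mul1_mul1DZ => hv.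
by apply/linear_annihilatorP; apply: hq hv.
Qed.

Lemma exists_injective_on_z : exists l, injective_on_z l.
Proof.
apply: NNPP => /square_mul_ideal sq.
(* Polarization of the square, with 2 invertible. *)
have prod3 (a b c : V 1) : I (val z * (val a * (val b * val c))).
  apply: (@in_idealZ _ _ _ 2%:R) => //.
  have -> : 2%:R *: (val z * (val a * (val b * val c))) =
    val z * (val a * (val (b + c) * val (b + c))) -
    val z * (val a * (val b * val b)) - val z * (val a * (val c * val c)).
    by rewrite /= scaler_nat; ring.
  by do 2?apply: in_idealB; apply: sq.
have homS d (P : {mpoly K[n.+1]} -> Prop) : P 0 -> (forall p q, P p -> P q -> P (p + q)) ->
    (forall (x : V 1) (y : V d), P (val x * val y)) -> forall u : V d.+1, P (val u).
  move=> P0 PD PM u; have [q hq ->] := homogSE (dhomog_is_dhomog u).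
  elim/big_ind: _ => // i _.
  have hX : ('X_i : {mpoly K[n.+1]}) \is 1.-homog by rewrite dhomogX /= mdeg1.
  exact: (PM (DHomog hX) (DHomog (hq i))).
have cubic (u : V 3) : I (val z * val u).
  apply: (homS _ (fun p => I (val z * p))) => [|p q|x y].
  - by rewrite mulr0; apply: in_ideal0.
  - by rewrite mulrDr; apply: in_idealD.
  apply: (homS _ (fun p => I (val z * (val x * p)))) => [|p q|y1 y2].
  - by rewrite !mulr0; apply: in_ideal0.
  - by rewrite !mulrDr; apply: in_idealD.
  exact: prod3.
have wz : I (val w * val z) by rewrite mulrC.
(* The roles of [z] and [w] are exchanged: a cubic killed by [z] lies in [(w) + I]. *)
case/negP: (cubics_not_quotient_part quad reg sz n5 w0 z0 wz).
have [c [p [cp zwE]]] := linear_mul_combination quad z0 w0 zw.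
rewrite eqEsubv subvf /=; apply/subvP => u _; apply/mem_quotient_part.
have [h hh uI] := colon_linear quad reg (dhomog_is_dhomog z) zwE cp
  (dhomog_is_dhomog u) (cubic u).
by exists (DHomog hh).
Qed.

(** With [injective_on_z], this concerns the outer terms of [0 -> zR -> R -> R/(z) -> 0] under
    multiplication by [l] from degree 2 to 3. *)
Definition injective_mod_z l :=
  forall f : V 2, mul1 2 l f \in quotient_part quad 1 z -> f \in quotient_part quad 0 z.

(** On the pencil [l1 + t (l2 - l1)] one open condition holds at [t = 0] and the other at [t = 1],
    so some [t] satisfies both. *)
Lemma exists_mult_inj2 l1 : injective_mod_z l1 -> exists l, mult_inj gens 2 (val l).
Proof.
move=> inj1; have [l2 inj2] := exists_injective_on_z.
have [|||p p0 hp] := @pencil_open _ _ _ (mul1 2 l1) (mul1 2 (l2 - l1))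
    (quotient_part quad 0 z) (quotient_part quad 1 z) 0.
- exact: mul1_quotient_part.
- exact: mul1_quotient_part.
- by move=> f; rewrite scale0r addr0; apply: inj1.
have [|||q q0 hq] := @pencil_open _ _ _ (mul1 2 z \o mul1 1 l1)%VF
    (mul1 2 z \o mul1 1 (l2 - l1))%VF <[w]>%VS (ideal_part quad 1) 1.
- exact: mul1_mul1_line.
- exact: mul1_mul1_line.
- move=> g; rewrite -mul1_mul1DZ scale1r addrC subrK => /mul1_mul1_ideal/inj2.
  by move/linear_annihilatorP.
have /closed_nonrootP[t] : p * q != 0 by rewrite mulf_neq0.
rewrite rootM negb_or => /andP[pt qt]; exists (l1 + t *: (l2 - l1)) => f hf lf.
have lf1 : mul1 2 (l1 + t *: (l2 - l1)) (DHomog hf) \in ideal_part quad 1.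
  by apply/mem_ideal_part; rewrite mul1E.
have : DHomog hf \in quotient_part quad 0 z.
  apply: (hp t) => //; rewrite -mul1DZ.
  exact: (subvP (addvSr _ _)).
case/mem_quotient_part => g fg.
(* Since [f] is [z g] modulo [I], the relation [lf] passes to [z g]. *)
have zlg : I (val z * (val (l1 + t *: (l2 - l1)) * val g)).
  have -> : val z * (val (l1 + t *: (l2 - l1)) * val g) =
    val (l1 + t *: (l2 - l1)) * f - val (l1 + t *: (l2 - l1)) * (f - val z * val g) by ring.
  by apply: in_idealB => //; apply: in_idealM.
have /linear_annihilatorP zg : g \in <[w]>%VS.
  by apply: (hq t) => //; rewrite -mul1_mul1DZ; apply/mul1_mul1_ideal.
by rewrite -[f](subrK (val z * val g)); apply: in_idealD.
Qed.

End Lefschetz.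

Theorem mainTheorem14 (K : closedFieldType) (n : nat)
    (hchar : [pchar K] =i pred0) (hn : (5 <= n)%N)
    (fs : seq {mpoly K[n.+1]}) (hR : CI_quadrics fs)
    (z : {mpoly K[n.+1]}) (hz1 : z \is 1.-homog) (hz0 : ~ in_ideal fs z)
    (hnonL : ~ mult_inj fs 1 z)
    (hbar : WLP (rcons fs z) 2) :
  WLP fs 2.
Proof.
case: hR => sz [quad reg].
have [w [w1 [zw nw]]] : exists w, w \is 1.-homog /\ in_ideal fs (z * w) /\ ~ in_ideal fs w.
  apply: NNPP => no; apply: hnonL => w w1 zw; apply: NNPP => nw.
  by apply: no; exists w.
have neq0 u (hu : u \is 1.-homog) : ~ in_ideal fs u -> DHomog hu != 0.
  move=> nu; apply/eqP => /(congr1 val) /= u0; apply: nu; rewrite u0.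
  exact: in_ideal0.
have z0 := neq0 z hz1 hz0; have w0 := neq0 w w1 nw.
have two0 : (2%:R : K) != 0.
  by have /negbT := hchar 2%N; rewrite !inE.
case: hbar => l [l1 hl].
suff inj : injective_mod_z quad (DHomog hz1) (DHomog l1).
  have [l' hl'] := exists_mult_inj2 reg sz hn two0 z0 w0 zw inj.
  by exists (val l'); split; [exact: dhomog_is_dhomog|left].
case: hl => [inj|surj] f.
  move=> /mem_ideal_rcons; rewrite mul1E => /inj h.
  exact/mem_ideal_rcons/h/dhomog_is_dhomog.
apply: (quotient_surj_inj reg sz hn z0 w0 zw).
(* Surjectivity on [R/(z)] is restated as an equality of subspaces of cubics. *)
apply/eqP; rewrite eqEsubv subvf; apply/subvP => g _.
have [u [hu gu]] := surj _ (dhomog_is_dhomog g).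
rewrite -[g](subrK (mul1 2 (DHomog l1) (DHomog hu))) addrC memv_add ?memv_img ?memvf //.
by apply/mem_ideal_rcons; rewrite /= mul1E.
Qed.
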